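(* For every monoid $M$ there is a (set-theoretic) bijection $$\mathsf{Cong}(M)\longrightarrow\bigcup_{S\in\mathsf{NorSub}(M)}\mathsf{Cong}_1(M/S)$$ given by $R\mapsto t_{[1]_R}(R)$, whose inverse is given by $T\mapsto t^*_S(T)$ for each $T\in\mathsf{Cong}_1(M/S)$. Moreover, the exceptional congruences on $M$ are mapped through this bijection to the non-trivial unital congruences on the normal quotients of $M$.
   Context: For a monoid $M$ with identity $1$, $U(M)$ denotes its group of units (elements with a two-sided inverse). A groupal submonoid of $M$ is a submonoid $S\subseteq M$ such that $x^{-1}\in S$ for every $x\in S\cap U(M)$. For $A\subseteq M$ and $x,y\in M$, $xAy=\{xay : a\in A\}$. A subset $A\subseteq M$ is invariant if for each $x,y\in M$ the following three conditions are equivalent: (i) $xAy\subseteq A$; (ii) $xy\in A$; (iii) $(xAy)\cap A\neq\emptyset$. A normal submonoid of $M$ is a submonoid which is both groupal and invariant; $\mathsf{NorSub}(M)$ is the set of normal submonoids of $M$. $\mathsf{Cong}(M)$ is the set of congruences on $M$ (equivalence relations compatible with the product). For a congruence $R$, $[x]_R$ is the equivalence class of $x$; $[1]_R$ is always a normal submonoid of $M$. For $S\in\mathsf{NorSub}(M)$, $R_S$ is the smallest congruence on $M$ containing $\{1\}\times S$, and $M/S:=M/R_S$. A congruence on $M$ is normal if it equals $R_S$ for some normal submonoid $S$ of $M$, and exceptional otherwise. The normal quotients of $M$ are the quotients of $M$ modulo its normal congruences, i.e. the monoids $M/S$. A congruence $R$ on a monoid is unital if the class of the identity element is $\{1\}$;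 it is non-trivial if it is not the equality relation. $\mathsf{Cong}_1(N)$ is the set of unital congruences on a monoid $N$. For $S\in\mathsf{NorSub}(M)$ let $\mathsf{Cong}_S(M):=\{R\in\mathsf{Cong}(M) : [1]_R=S\}$. The map $t_S:\mathsf{Cong}_S(M)\to\mathsf{Cong}_1(M/S)$ is $t_S(R):=\{([x]_{R_S},[y]_{R_S}) : (x,y)\in R\}$, and the map $t^*_S:\mathsf{Cong}_1(M/S)\to\mathsf{Cong}_S(M)$ is $t^*_S(T):=\{(x,y)\in M\times M : ([x]_{R_S},[y]_{R_S})\in T\}$. Congruences on $M/S$ for different $S$ are regarded as different elements of the union. *)

(* Defs.v *)
From HB Require Import structures.
From mathcomp Require Import all_boot.
From mathcomp Require Import boolp classical_sets functions.

Set Implicit Arguments.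
Unset Strict Implicit.
Unset Printing Implicit Defensive.

Local Open Scope classical_set_scope.
Local Open Scope group_scope.
Local Open Scope quotient_scope.

Section Submonoids.
Variable M : monoidType.
Implicit Types (x y : M) (S A : set M).

Definition units : set M := [set x | exists y, x * y = 1 /\ y * x = 1].

Definition submonoid S := S 1 /\ forall x y, S x -> S y -> S (x * y).

(* [monoidType] has no inverse operation: "x^-1 belongs to S" is stated for the
   two-sided inverse [y] of [x]. *)
Definition groupal S :=
  submonoid S /\
  forall x, (S `&` units) x ->
  forall y, x * y = 1 -> y * x = 1 -> S y.

Definition two_sided_translate x A y : set M := [set x * a * y | a in A].

Definition invariant_set A := forall x y,
  (two_sided_translate x A y `<=` A <-> A (x * y)) /\
  (A (x * y) <-> two_sided_translate x A y `&` A !=set0).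

Definition NorSub : set (set M) := [set S | groupal S /\ invariant_set S].

End Submonoids.

Arguments NorSub : clear implicits.

Section Congruences.
Variable M : monoidType.
Implicit Types (R : set (M * M)) (S : set M).

Definition congruence R :=
  [/\ forall x, R (x, x),
      forall x y, R (x, y) -> R (y, x),
      forall x y z, R (x, y) -> R (y, z) -> R (x, z) &
      forall x y z t, R (x, y) -> R (z, t) -> R (x * z, y * t)].

Definition Cong : set (set (M * M)) := [set R | congruence R].

Definition cong_class R (x : M) : set M := [set y | R (x, y)].

Definition unital R := cong_class R 1 = [set 1].

Definition Cong1 : set (set (M * M)) := [set R | Cong R /\ unital R].

Definition nontrivial R := R <> diagonal.

Definition congS S : set (M * M) := smallest Cong ([set 1] `*` S).

Definition normal_congruence R := exists2 S, NorSub M S & R = congS S.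

Definition exceptional : set (set (M * M)) :=
  [set R | Cong R /\ ~ normal_congruence R].

Lemma congS_congruence S : congruence (congS S).
Proof.
split=> [x|x y h|x y z h1 h2|x y z t h1 h2] R [cR SR]; have [rR sR tR mR] := cR.
- exact: rR.
- by apply: sR; exact: h.
- by apply: tR (h1 _ _) (h2 _ _).
- by apply: mR; [exact: h1 | exact: h2].
Qed.

End Congruences.

Arguments Cong : clear implicits.
Arguments Cong1 : clear implicits.
Arguments exceptional : clear implicits.

Section QuotientMonoid.
Variables (M : monoidType) (R : set (M * M)) (cR : congruence R).

Definition cong_rel : rel M := fun x y => `[< R (x, y) >].

Lemma cong_rel_refl : reflexive cong_rel.
Proof. by move=> x; apply/asboolP; case: cR. Qed.

Lemma cong_rel_sym : symmetric cong_rel.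
Proof.
by case: cR => _ sR _ _ x y; apply/asboolP/asboolP; exact: sR.
Qed.

Lemma cong_rel_trans : transitive cong_rel.
Proof.
case: cR => _ _ tR _ y x z /asboolP xy /asboolP yz.
by apply/asboolP; exact: tR xy yz.
Qed.

Definition cong_equiv_rel :=
  EquivRel cong_rel cong_rel_refl cong_rel_sym cong_rel_trans.

Definition quot := {eq_quot cong_equiv_rel}.

HB.instance Definition _ := Choice.on quot.
HB.instance Definition _ := Quotient.on quot.
HB.instance Definition _ := EqQuotient.on quot.

Definition proj (x : M) : quot := \pi_quot x.

Definition quot_mul (a b : quot) : quot := proj (repr a * repr b).

Lemma proj_eq x y : proj x = proj y <-> R (x, y).
Proof.
by split=> [/eqP|h]; [rewrite eqmodE => /asboolP | apply/eqP; rewrite eqmodE; apply/asboolP].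
Qed.

Lemma proj_repr (a : quot) : proj (repr a) = a.
Proof. exact: reprK. Qed.

Lemma projM x y : proj (x * y) = quot_mul (proj x) (proj y).
Proof.
case: (cR) => _ _ _ mR.
by apply/proj_eq; apply: mR; apply/proj_eq; rewrite proj_repr.
Qed.

Lemma quot_mulA : associative quot_mul.
Proof.
move=> a b c; rewrite -(proj_repr a) -(proj_repr b) -(proj_repr c).
by rewrite -!projM mulgA.
Qed.

Lemma quot_mul1 : left_id (proj 1) quot_mul.
Proof. by move=> a; rewrite -(proj_repr a) -projM mul1g. Qed.

Lemma quot_1mul : right_id (proj 1) quot_mul.
Proof. by move=> a; rewrite -(proj_repr a) -projM mulg1. Qed.

HB.instance Definition _ := isSemigroup.Build quot quot_mulA.
HB.instance Definition _ := Semigroup_isMonoid.Build quot quot_mul1 quot_1mul.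

End QuotientMonoid.

Section NormalQuotients.
Variable M : monoidType.
Implicit Types S : set M.

(* M/S, defined for every subset S because [congS S] is always a congruence;
   it has its intended meaning for S in [NorSub M]. *)
Definition nquot S : monoidType := quot (congS_congruence S).

Definition nproj S (x : M) : nquot S := proj (congS_congruence S) x.

Definition t_map S (R : set (M * M)) : set (nquot S * nquot S) :=
  [set (nproj S xy.1, nproj S xy.2) | xy in R].

Definition tstar_map S (T : set (nquot S * nquot S)) : set (M * M) :=
  [set xy | T (nproj S xy.1, nproj S xy.2)].

(* The union over S is rendered as a disjoint union: an element is a pair of a
   normal submonoid S and a unital congruence on M/S. *)
Definition tagged_relation := {S : set M & set (nquot S * nquot S)}.

Definition unionCong1 : set tagged_relation :=
  [set ST | NorSub M (projT1 ST) /\ Cong1 (nquot (projT1 ST)) (projT2 ST)].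

(* For R in [Cong M], [cong_class R 1] is a normal submonoid; the value at other
   sets R is irrelevant. *)
Definition to_union (R : set (M * M)) : tagged_relation :=
  existT _ (cong_class R 1) (@t_map (cong_class R 1) R).

Definition of_union (ST : tagged_relation) : set (M * M) := @tstar_map (projT1 ST) (projT2 ST).

Definition nontrivial_unionCong1 : set tagged_relation :=
  [set ST | unionCong1 ST /\ nontrivial (projT2 ST)].

End NormalQuotients.

Arguments t_map {M} S R _.
Arguments tstar_map {M} S T _.
Arguments tagged_relation : clear implicits.
Arguments unionCong1 : clear implicits.
Arguments nontrivial_unionCong1 : clear implicits.

(* Main.v *)
Require Import Defs.
From mathcomp Require Import all_boot.
From mathcomp Require Import boolp classical_sets functions.
Local Open Scope classical_set_scope.

(** If S is the class of 1 modulo a congruence R, then R contains R_S, so R is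
    the pullback of a congruence on M/S, which is unital because the class of 1
    modulo R_S is S again.  That last fact is seen by comparing R_S with the
    syntactic congruence of S, which identifies x and y when no context u _ v
    separates them with respect to membership in S. *)

Local Open Scope group_scope.

Definition syntactic_congruence {M : monoidType} (S : set M) : set (M * M) :=
  [set xy | forall u v, S (u * xy.1 * v) <-> S (u * xy.2 * v)].

Lemma congruence_syntactic {M : monoidType} (S : set M) :
  congruence (syntactic_congruence S).
Proof.
split=> [x u v|x y xy u v|x y z xy yz u v|x y z t xy zt u v] /=.
- by [].
- exact: iff_sym (xy u v).
- exact: iff_trans (xy u v) (yz u v).
(* Replace one factor at a time: [z] is first absorbed into the right context, then [y] into the
   left one. *)
- apply: (@iff_trans _ (S (u * (y * z) * v))).
    by have := xy u (z * v); rewrite /= !mulgA.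
  by have := zt (u * y) v; rewrite /= !mulgA.
Qed.

Lemma sub_congS {M : monoidType} (R : set (M * M)) S :
  Cong M R -> S `<=` cong_class R 1 -> congS S `<=` R.
Proof. by move=> cR SR xy; apply; split=> // -[x s] [/= -> /SR]. Qed.

Lemma cong_class_congS {M : monoidType} (S : set M) :
  NorSub M S -> cong_class (congS S) 1 = S.
Proof.
move=> [[[S1 _] _] invS]; apply/seteqP; split=> [x|s Ss] /=; last first.
  by move=> R [_]; apply.
have sub : S `<=` cong_class (syntactic_congruence S) 1.
  (* Invariance says exactly that inserting [s] between [u] and [v] does not change membership in
     [S]. *)
  move=> s Ss u v /=; rewrite mulg1; have [i_ii ii_iii] := invS u v.
  split=> [/i_ii|usv]; first by apply; exists s.
  by apply/ii_iii; exists (u * s * v); split=> //; exists s.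
(* In the empty context, membership in [S] passes from [1] to [x]. *)
move/(sub_congS _ _ (congruence_syntactic S) sub) => /(_ 1 1) /=.
by rewrite !mul1g !mulg1 => -[+ _]; apply.
Qed.

Lemma NorSub_cong_class {M : monoidType} (R : set (M * M)) :
  Cong M R -> NorSub M (cong_class R 1).
Proof.
move=> [rR sR tR mR].
(* Makes [x * y] and all elements [x * a * y] equivalent, so that the three conditions of invariance
   hold or fail together. *)
have absorb x y a : R (1, a) -> R (x * y, x * a * y).
  by move=> Ra; rewrite -[X in X * y]mulg1; do 2!apply: (mR) => //.
split; first split; first split.
- exact: rR.
- by move=> x y Rx Ry; have := mR _ _ _ _ Rx Ry; rewrite mulg1.
- move=> x [/sR Rx _] y xy _; rewrite /cong_class /= -xy.
  by have := mR _ _ _ _ Rx (rR y); rewrite mul1g.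
- move=> x y; split; split.
  + by apply; exists 1; [exact: rR | rewrite mulg1].
  + by move=> Rxy _ [a Ra <-]; exact: tR Rxy (absorb _ _ _ Ra).
  + by move=> Rxy; exists (x * y); split=> //; exists 1; [exact: rR | rewrite mulg1].
  + by move=> [_ [[a Ra <-] Rxay]]; apply: tR Rxay _; apply/sR/absorb.
Qed.

Lemma nprojE {M : monoidType} (S : set M) x y :
  nproj S x = nproj S y <-> congS S (x, y).
Proof. exact: proj_eq. Qed.

Lemma nprojM {M : monoidType} (S : set M) x y :
  nproj S (x * y) = nproj S x * nproj S y.
Proof. exact: projM. Qed.

Lemma nproj1 {M : monoidType} (S : set M) : nproj S 1 = 1.
Proof. by []. Qed.

Lemma nproj_surj {M : monoidType} (S : set M) (a : nquot S) :
  exists x, nproj S x = a.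
Proof. by exists (repr a); exact: proj_repr. Qed.

(** The kernel of the projection is the class of 1 modulo [congS S]. This is how normality of [S]
    enters the arguments about unital congruences on the quotient. *)
Lemma nproj_eq1 {M : monoidType} (S : set M) x :
  NorSub M S -> nproj S x = 1 <-> S x.
Proof.
move=> nS; rewrite -[X in _ <-> X x](cong_class_congS S nS) /cong_class /=.
by rewrite -nprojE nproj1; split=> ->.
Qed.

(** Membership in the image only yields some representatives related by [R]; as [R] contains
    [congS S], they can be exchanged for [x] and [y]. *)
Lemma t_mapE {M : monoidType} (R : set (M * M)) S x y :
  Cong M R -> congS S `<=` R -> t_map S R (nproj S x, nproj S y) <-> R (x, y).
Proof.
move=> [rR sR tR mR] SR; split=> [[[z t] /= Rzt [zx ty]]|]; last by exists (x, y).
have Rxz : R (x, z) by apply/SR/nprojE.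
by apply: tR (tR _ _ _ Rxz Rzt) _; apply/SR/nprojE.
Qed.

Lemma t_mapK {M : monoidType} (R : set (M * M)) S :
  Cong M R -> congS S `<=` R -> tstar_map S (t_map S R) = R.
Proof.
by move=> cR SR; apply/seteqP; split=> -[x y] /=; rewrite /tstar_map /= t_mapE.
Qed.

Lemma tstar_mapK {M : monoidType} S (T : set (nquot S * nquot S)) :
  t_map S (@tstar_map M S T) = T.
Proof.
apply/seteqP; split=> [_ [[x y] Txy <-]//|[a b]].
by have [x <-] := nproj_surj S a; have [y <-] := nproj_surj S b; exists (x, y).
Qed.

Lemma congS_cong_class_sub {M : monoidType} (R : set (M * M)) :
  Cong M R -> congS (cong_class R 1) `<=` R.
Proof. by move=> cR; apply: sub_congS. Qed.

Lemma Cong_tstar_map {M : monoidType} S (T : set (nquot S * nquot S)) :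
  Cong (nquot S) T -> Cong M (tstar_map S T).
Proof.
move=> [rT sT tT mT]; split=> [x|x y|x y z|x y z t]; rewrite /tstar_map /=.
- exact: rT.
- exact: sT.
- exact: tT.
- by rewrite !nprojM; exact: mT.
Qed.

Lemma Cong_t_map {M : monoidType} (R : set (M * M)) S :
  Cong M R -> congS S `<=` R -> Cong (nquot S) (t_map S R).
Proof.
move=> cR SR; have [rR sR tR mR] := cR; split=> [a|a b|a b c|a b c d].
all: have [x <-] := nproj_surj S a.
- exact/t_mapE.
- by have [y <-] := nproj_surj S b; rewrite !t_mapE //; exact: sR.
- have [y <-] := nproj_surj S b; have [z <-] := nproj_surj S c.
  by rewrite !t_mapE //; exact: tR.
- have [y <-] := nproj_surj S b; have [z <-] := nproj_surj S c.
  have [t <-] := nproj_surj S d.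
  by rewrite -!nprojM !t_mapE //; exact: mR.
Qed.

(** The class of 1 is pulled back from [[set 1]], so it is the kernel of the projection. Hence the
    tag [S] can be recovered from the pullback. *)
Lemma cong_class_tstar_map {M : monoidType} S (T : set (nquot S * nquot S)) :
  NorSub M S -> unital T -> cong_class (tstar_map S T) 1 = S.
Proof.
move=> nS uT; apply/seteqP; split=> x.
  move=> Tx; apply/nproj_eq1 => //.
  by have : cong_class T 1 (nproj S x) by []; rewrite uT.
move=> /(nproj_eq1 _ _ nS) x1; rewrite /cong_class /tstar_map /= x1.
by have : cong_class T 1 1 by rewrite uT.
Qed.

Lemma to_union_sub {M : monoidType} :
  set_fun (Cong M) (unionCong1 M) (@to_union M).
Proof.
move=> R cR; have nS := NorSub_cong_class R cR.
have SR := congS_cong_class_sub R cR.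
split=> //; split; first exact: Cong_t_map.
apply/seteqP; split=> a; have [x <-] := nproj_surj (cong_class R 1) a.
  by move/(t_mapE _ _ _ _ cR SR) => Rx; apply/nproj_eq1.
by move/(nproj_eq1 _ _ nS) => Rx; apply/(t_mapE _ _ _ _ cR SR).
Qed.

Lemma to_unionK {M : monoidType} (R : set (M * M)) :
  Cong M R -> of_union (to_union R) = R.
Proof. by move=> cR; apply: t_mapK => //; exact: congS_cong_class_sub. Qed.

Lemma of_unionK {M : monoidType} (ST : tagged_relation M) :
  unionCong1 M ST -> to_union (of_union ST) = ST.
Proof.
case: ST => S T [/= nS [_ uT]].
(* The tag is rewritten to [S] in both components at once, so that the second one acquires the type
   of [T]. *)
rewrite /to_union /of_union /= (cong_class_tstar_map _ _ nS uT).
by rewrite tstar_mapK.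
Qed.

(** Triviality on the quotient means that pairs in [R] are already identified by [congS S], the
    inclusion missing from [SR]. *)
Lemma t_map_diagonal {M : monoidType} (R : set (M * M)) S :
  Cong M R -> congS S `<=` R -> t_map S R = diagonal <-> R = congS S.
Proof.
move=> cR SR; split=> [tR|RS].
  apply/seteqP; split=> // -[x y] Rxy; apply/nprojE.
  have : t_map S R (nproj S x, nproj S y) by exact/t_mapE.
  by rewrite tR.
apply/seteqP; split=> -[a b]; have [x <-] := nproj_surj S a.
  have [y <-] := nproj_surj S b.
  by move/(t_mapE _ _ _ _ cR SR); rewrite RS => /nprojE.
by rewrite /diagonal /= => <-; apply/t_mapE => //; case: cR.
Qed.

(** A normal submonoid is the class of 1 of the congruence it generates, which leaves a single
    candidate for [S]. *)
Lemma normal_congruenceE {M : monoidType} (R : set (M * M)) :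
  Cong M R -> normal_congruence R <-> R = congS (cong_class R 1).
Proof.
move=> cR; split=> [[S nS ->]|RS]; first by rewrite cong_class_congS.
by exists (cong_class R 1) => //; exact: NorSub_cong_class.
Qed.

Lemma exceptionalE {M : monoidType} (R : set (M * M)) :
  Cong M R -> exceptional M R <-> nontrivial_unionCong1 M (to_union R).
Proof.
move=> cR; have normalE : normal_congruence R <-> projT2 (to_union R) = diagonal.
  rewrite normal_congruenceE // t_map_diagonal //.
  exact: congS_cong_class_sub.
split=> [[_ nR]|[_ ntR]].
  by split; [exact: to_union_sub | move/normalE].
by split=> // /normalE.
Qed.

Theorem theorem3p15 (M : monoidType) :
  [/\ set_bij (Cong M) (unionCong1 M) (@to_union M),
      set_fun (unionCong1 M) (Cong M) (@of_union M),
      (forall R : set (M * M), Cong M R -> of_union (to_union R) = R),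
      (forall ST : tagged_relation M,
         unionCong1 M ST -> to_union (of_union ST) = ST) &
      @to_union M @` exceptional M = nontrivial_unionCong1 M].
Proof.
have of_union_sub : set_fun (unionCong1 M) (Cong M) (@of_union M).
  by move=> [S T] [_ [cT _]]; exact: Cong_tstar_map.
split=> //; [split| exact: to_unionK | exact: of_unionK |].
- exact: to_union_sub.
- move=> R1 R2 /set_mem cR1 /set_mem cR2 eqR.
  by rewrite -(to_unionK R1 cR1) eqR to_unionK.
- by move=> ST uST; exists (of_union ST); [exact: of_union_sub | exact: of_unionK].
- apply/seteqP; split=> [_ [R eR <-]|ST ntST].
    by apply/exceptionalE => //; case: eR.
  (* [exceptionalE] applies to the preimage [of_union ST], since [to_union] sends it back to
     [ST]. *)
  have [uST _] := ntST; exists (of_union ST); last exact: of_unionK.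
  by apply/exceptionalE; [exact: of_union_sub | rewrite of_unionK].
Qed.
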